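(* Let $\bar p>0$ be fixed, and assume the following conditions. E.1: the data $X_i$, $i=1,\dots,n$, are i.i.d. copies of $X$. E.2: for $\bar p\in(0,1)$ there is a positive number $v(\bar p)$ such that $$\sup_{x\in\mathcal{S},p_x\ge\bar p}\left|\frac{\mathbb{P}_n(X_i\preccurlyeq x)-P(X\preccurlyeq x)}{p_x}\right|\vee\left|\frac{\mathbb{P}_n(X_i\succcurlyeq x)-P(X\succcurlyeq x)}{p_x}\right|\vee\left|\frac{\hat p_x-p_x}{p_x}\right|\lesssim_P\sqrt{v(\bar p)/n}.$$ E.6: the process $\alpha_n(A)=\sqrt n(\mathbb{P}_n(A)-P(A))$, $A\in\mathcal{T}$, converges weakly in $\ell^\infty(\mathcal{T})$ to a bounded, mean zero Gaussian process $Z_P$ indexed by $\mathcal{T}$ with covariance function $P(A\cap B)-P(A)P(B)$, $A,B\in\mathcal{T}$. Then, if $v(\bar p)=o(n)$, for any $x\in\mathcal{C}_{\bar p}$, $$\sqrt n(\hat\tau_x-\tau_x)\rightsquigarrow N\left(0,\frac{\tau_x(1-\tau_x)}{p_x}\right).$$ Moreover, the process $\beta_n(x)=\sqrt n(\hat\tau_x-\tau_x)$ indexed by $\mathcal{C}_{\bar p}$ converges weakly in $\ell^\infty(\mathcal{C}_{\bar p})$ to a bounded, mean zero Gaussian process $G_P$ indexed by $\mathcal{C}_{\bar p}$ with covariance function given, for any $z,y\in\mathcal{C}_{\bar p}$, by $$\Omega_{z,y}=\tau_z\tau_y\left(\frac{P(X\preccurlyeq z\cap X\preccurlyeq y)}{P(X\preccurlyeq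 z)P(X\preccurlyeq y)}+\frac{P(\mathcal{C}(z)\cap\mathcal{C}(y))}{p_zp_y}-\frac{P(\mathcal{C}(z)\cap X\preccurlyeq y)}{p_zP(X\preccurlyeq y)}-\frac{P(X\preccurlyeq z\cap\mathcal{C}(y))}{P(X\preccurlyeq z)p_y}\right).$$
   Context: $X$ is a random variable on $(\Omega,\mathcal{A},P)$ with values in an arbitrary set $\mathcal{S}$ with a partial order $\preccurlyeq$ ($x\succcurlyeq y$ means $y\preccurlyeq x$); the events $\{X\succcurlyeq x\}$, $\{X\preccurlyeq x\}$ are measurable for all $x$. $\mathcal{C}(x)=\{y\in\mathcal{S}: y\succcurlyeq x\text{ or }y\preccurlyeq x\}$, also used for the event $\{X\in\mathcal{C}(x)\}$; for $A\subset\mathcal{S}$, $P(A)=P(X\in A)$; $P(X\preccurlyeq z\cap X\preccurlyeq y)$ is the probability of the intersection of $\{X\preccurlyeq z\}$ and $\{X\preccurlyeq y\}$. $p_x=P(\mathcal{C}(x))$, $\tau_x=P(X\preccurlyeq x\mid\mathcal{C}(x))$. $\mathcal{C}_{\bar p}=\{x\in\mathcal{S}:p_x\ge\bar p\}$. $\mathcal{T}=\{\mathcal{C}(x),\{y\in\mathcal{S}:y\preccurlyeq x\},\{y\in\mathcal{S}:y\succcurlyeq x\}: x\in\mathcal{S}\}$. $\mathbb{P}_n(A)=\frac1n\sum_{i=1}^n1\{X_i\in A\}$; $\mathbb{P}_n(A\mid B)=\mathbb{P}_n(A\cap B)/\mathbb{P}_n(B)$ if $\mathbb{P}_n(B)>0$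 and zero otherwise; $\hat p_x=\mathbb{P}_n(\mathcal{C}(x))$; $\hat\tau_x=\mathbb{P}_n(X_i\preccurlyeq x\mid\mathcal{C}(x))$. Asymptotics are as $n\to\infty$; $a\lesssim_P b$ means $a=O_P(b)$; $\rightsquigarrow$ is convergence in distribution. *)

(* Defs.v *)
From HB Require Import structures.
From mathcomp Require Import all_boot all_order all_algebra.
From mathcomp Require Import all_classical all_reals all_analysis.

Set Implicit Arguments.
Unset Strict Implicit.
Unset Printing Implicit Defensive.

Import Order.TTheory GRing.Theory Num.Theory.
Import numFieldNormedType.Exports.

Local Open Scope classical_set_scope.
Local Open Scope ring_scope.

Lemma bounded_fun_le (T : Type) (R : realType) (f : T -> R) (M : R) :
  (forall t, `|f t| <= M) -> bounded_fun f.
Proof.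
move=> fM; exists M; split; first exact: num_real.
by move=> N MN t _; rewrite /= (le_trans (fM t))// ltW.
Qed.

(* l^oo(T): the bounded real functions on T, with the topology of uniform
   convergence (that of the supremum norm). *)
Record linfty (T : choiceType) (R : realType) := Linfty {
  linfty_fun :> T -> R ;
  linfty_bounded : bounded_fun linfty_fun }.

Definition linfty_uniform (T : choiceType) (R : realType) (f : linfty T R) :
  arrow_uniform_type T R := linfty_fun f.

Lemma linfty0_bounded (T : choiceType) (R : realType) :
  bounded_fun (fun _ : T => 0 : R).
Proof. by apply: (@bounded_fun_le _ _ _ 0) => t; rewrite normr0. Qed.

Section linfty_instances.
Context (T : choiceType) (R : realType).

HB.instance Definition _ := gen_eqMixin (linfty T R).
HB.instance Definition _ := gen_choiceMixin (linfty T R).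
HB.instance Definition _ :=
  isPointed.Build (linfty T R) (Linfty (@linfty0_bounded T R)).
HB.instance Definition _ := PseudoMetric.copy (linfty T R)
  (initial_topology (@linfty_uniform T R)).

End linfty_instances.

Definition borel (E : ptopologicalType) := g_sigma_algebraType (@open E).

Section probability.
Context d (W : measurableType d) (R : realType) (P : probability W R).

(* Outer expectation of H; the infimum over integrable majorants is the usual
   E^* H for bounded H, the only case in which it is used. *)
Definition outer_expectation (H : W -> R) : \bar R :=
  ereal_inf [set (\int[P]_w U w)%E | U in
    [set U : W -> \bar R | P.-integrable setT U /\
                           forall w, ((H w)%:E <= U w)%E]].

(* Y_n = O_P(b_n); mu_ext P is the outer probability, as Y_n need not be
   measurable. *)
Definition bigO_P (Y : nat -> W -> R) (b : nat -> R) : Prop :=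
  forall e : R, 0 < e -> exists M : R, \forall n \near \oo,
    (mu_ext P [set w | (M * b n < `|Y n w|)%R] <= e%:E)%E.

Definition cvg_in_distribution (Y : nat -> W -> R) (L : set R -> \bar R) : Prop :=
  (forall n, measurable_fun setT (Y n)) /\
  forall f : R -> R, continuous f -> bounded_fun f ->
    (fun n => \int[P]_w (f (Y n w))%:E)%E @ \oo --> (\int[L]_y (f y)%:E)%E.

(* Weak convergence (Hoffmann-Jorgensen) of possibly nonmeasurable maps to a
   Borel measurable limit Z, itself defined on a probability space (W', Q). *)
Definition weak_cvg (E : ptopologicalType) (Y : nat -> W -> E)
    d' (W' : measurableType d') (Q : probability W' R) (Z : W' -> E) : Prop :=
  measurable_fun setT (Z : W' -> borel E) /\
  forall f : E -> R, continuous f -> bounded_fun f ->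
    (fun n => outer_expectation (f \o Y n)) @ \oo
      --> (\int[Q]_w (f (Z w))%:E)%E.

Definition mutually_independent d' (S : measurableType d')
    (Xs : nat -> {RV P >-> S}) : Prop :=
  forall (J : seq nat) (B : nat -> set S), uniq J ->
    (forall i, measurable (B i)) ->
    P (\bigcap_(i in [set` J]) (Xs i @^-1` B i)) =
    (\prod_(i <- J) P (Xs i @^-1` B i))%E.

Definition iid_copies d' (S : measurableType d') (X : {RV P >-> S})
    (Xs : nat -> {RV P >-> S}) : Prop :=
  mutually_independent Xs /\
  forall i A, measurable A -> distribution P (Xs i) A = distribution P X A.

End probability.

(* N(m, v) with v the variance; normal_prob takes the standard deviation and
   is not the Dirac mass when it vanishes. *)
Definition normal_law (R : realType) (m v : R) : set R -> \bar R :=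
  if v == 0 then dirac m else normal_prob m (Num.sqrt v).

(* Gaussian process: every finite linear combination of its coordinates is
   normal (possibly degenerate). *)
Definition gaussian_process d (W : measurableType d) (R : realType)
    (Q : probability W R) (T : Type) (Z : T -> W -> R) : Prop :=
  (forall t, measurable_fun setT (Z t)) /\
  forall (s : seq T) (a : T -> R), exists m v : R, 0 <= v /\
    forall B : set R, measurable B ->
      Q ((fun w => \sum_(t <- s) a t * Z t w) @^-1` B) = normal_law m v B.

Definition weak_cvg_gaussian d (W : measurableType d) (R : realType)
    (P : probability W R) (T : choiceType) (Y : nat -> W -> linfty T R)
    (K : T -> T -> R) : Prop :=
  exists (d' : measure_display) (W' : measurableType d')
         (Q : probability W' R) (Z : W' -> linfty T R),
    [/\ weak_cvg P Y Q Z,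
        gaussian_process Q (fun t w => Z w t),
        forall t, ('E_Q[fun w => Z w t] = 0)%E &
        forall s t,
          covariance Q (fun w => Z w s) (fun w => Z w t) = (K s t)%:E].

Section partial_order.
Context (S : Type) (le : rel S).

Definition below (x : S) : set S := [set y | le y x].
Definition above (x : S) : set S := [set y | le x y].
Definition comparables (x : S) : set S := [set y | le x y || le y x].

Definition order_class : set (set S) :=
  [set A | exists x, [\/ A = comparables x, A = below x | A = above x]].

End partial_order.

Section population.
Context d d' (W : measurableType d) (S : measurableType d') (R : realType)
  (P : probability W R) (le : rel S) (X : {RV P >-> S}).

Definition Pr (A : set S) : R := fine (distribution P X A).
Definition p_ (x : S) : R := Pr (comparables le x).
Definition tau (x : S) : R :=
  Pr (below le x `&` comparables le x) / Pr (comparables le x).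

Definition C_ge (pbar : R) : set S := [set x | pbar <= p_ x].

(* When P(X <= z) = 0 (or P(X <= y) = 0) the convention r / 0 = 0 is harmless:
   the factor tau z * tau y then vanishes. *)
Definition Omega_cov (z y : S) : R :=
  tau z * tau y *
  (Pr (below le z `&` below le y) / (Pr (below le z) * Pr (below le y))
   + Pr (comparables le z `&` comparables le y) / (p_ z * p_ y)
   - Pr (comparables le z `&` below le y) / (p_ z * Pr (below le y))
   - Pr (below le z `&` comparables le y) / (Pr (below le z) * p_ y)).

End population.

Section empirical.
Context d d' (W : measurableType d) (S : measurableType d') (R : realType)
  (P : probability W R) (le : rel S) (Xs : nat -> {RV P >-> S}).

Definition Pn (n : nat) (w : W) (A : set S) : R :=
  n%:R^-1 * \sum_(i < n) \1_A (Xs i w).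

Definition Pn_cond (n : nat) (w : W) (A B : set S) : R :=
  if 0 < Pn n w B then Pn n w (A `&` B) / Pn n w B else 0.

Definition p_hat (n : nat) (w : W) (x : S) : R := Pn n w (comparables le x).
Definition tau_hat (n : nat) (w : W) (x : S) : R :=
  Pn_cond n w (below le x) (comparables le x).

Lemma Pn_ge0 n w A : 0 <= Pn n w A.
Proof.
rewrite /Pn mulr_ge0 ?invr_ge0 ?ler0n//.
by apply: sumr_ge0 => i _; rewrite indicE ler0n.
Qed.

Lemma Pn_mono n w A B : A `<=` B -> Pn n w A <= Pn n w B.
Proof.
move=> AB; rewrite /Pn ler_wpM2l ?invr_ge0 ?ler0n//.
apply: ler_sum => i _; rewrite !indicE ler_nat.
by case: (boolP (_ \in A)) => // /set_mem/AB/mem_set ->.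
Qed.

Lemma Pn_le1 n w A : Pn n w A <= 1.
Proof.
rewrite /Pn; case: n => [|n]; first by rewrite big_ord0 mulr0.
rewrite ler_pdivrMl ?ltr0Sn// mulr1.
apply: (@le_trans _ _ (\sum_(i < n.+1) (1 : R))); last first.
  by rewrite sumr_const card_ord.
by apply: ler_sum => i _; rewrite indicE lern1 leq_b1.
Qed.

Lemma Pn_cond_norm n w A B : `|Pn_cond n w A B| <= 1.
Proof.
rewrite /Pn_cond; case: ifPn => [B0|_]; last by rewrite normr0.
rewrite ger0_norm ?divr_ge0 ?Pn_ge0// ler_pdivrMr// mul1r.
by apply: Pn_mono => ? [].
Qed.

End empirical.

Section processes.
Context d d' (W : measurableType d) (S : measurableType d') (R : realType)
  (P : probability W R) (le : rel S) (X : {RV P >-> S})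
  (Xs : nat -> {RV P >-> S})
  (mbelow : forall x, measurable (below le x))
  (mabove : forall x, measurable (above le x)).

Lemma measurable_comparables x : measurable (comparables le x).
Proof.
rewrite (_ : comparables le x = above le x `|` below le x).
  exact: measurableU.
by apply/seteqP; split => y /orP.
Qed.

Lemma measurable_order_class (A : order_class le) : measurable (val A).
Proof.
have /set_mem[x [] ->] := valP A; [exact: measurable_comparables| |].
- exact: mbelow.
- exact: mabove.
Qed.

Lemma Pr_ge0 A : 0 <= Pr X A.
Proof. by rewrite fine_ge0. Qed.

Lemma Pr_mono A B : measurable A -> measurable B -> A `<=` B ->
  Pr X A <= Pr X B.
Proof.
by move=> mA mB AB; rewrite fine_le ?fin_num_measure// le_measure ?inE.
Qed.

Lemma Pr_le1 A : measurable A -> Pr X A <= 1.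
Proof.
by move=> mA; rewrite -lee_fin fineK ?fin_num_measure// probability_le1.
Qed.

Lemma tau_norm x : `|tau le X x| <= 1.
Proof.
rewrite /tau ger0_norm ?divr_ge0 ?Pr_ge0//.
have [C0|C0] := eqVneq (Pr X (comparables le x)) 0.
  by rewrite C0 invr0 mulr0.
rewrite ler_pdivrMr ?lt_neqAle ?Pr_ge0 1?eq_sym ?C0// mul1r.
have mC := measurable_comparables x.
by apply: Pr_mono => //; exact: measurableI.
Qed.

Lemma sqrt_process_bounded (T : Type) (n : nat) (f g : T -> R) :
  (forall t, `|f t| <= 1) -> (forall t, `|g t| <= 1) ->
  bounded_fun (fun t => Num.sqrt n%:R * (f t - g t)).
Proof.
move=> f1 g1; apply: (@bounded_fun_le _ _ _ (Num.sqrt n%:R * 2)) => t.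
rewrite normrM ger0_norm ?sqrtr_ge0// ler_wpM2l ?sqrtr_ge0//.
by rewrite (le_trans (ler_normB _ _))// -[leRHS]/(1 + 1) lerD.
Qed.

Lemma alpha_bounded n w : bounded_fun (fun A : order_class le =>
  Num.sqrt n%:R * (Pn Xs n w (val A) - Pr X (val A))).
Proof.
apply: sqrt_process_bounded => A; rewrite ger0_norm ?Pn_ge0 ?Pr_ge0 ?Pn_le1//.
exact/Pr_le1/measurable_order_class.
Qed.

Lemma beta_bounded pbar n w : bounded_fun (fun x : C_ge le X pbar =>
  Num.sqrt n%:R * (tau_hat le Xs n w (val x) - tau le X (val x))).
Proof.
by apply: sqrt_process_bounded => x; [exact: Pn_cond_norm|exact: tau_norm].
Qed.

Definition alpha (n : nat) (w : W) : linfty (order_class le) R :=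
  Linfty (alpha_bounded n w).

Definition beta (pbar : R) (n : nat) (w : W) : linfty (C_ge le X pbar) R :=
  Linfty (beta_bounded pbar n w).

Definition rel_error (n : nat) (w : W) (x : S) : R :=
  Num.max (Num.max
    `|(Pn Xs n w (below le x) - Pr X (below le x)) / p_ le X x|
    `|(Pn Xs n w (above le x) - Pr X (above le x)) / p_ le X x|)
    `|(p_hat le Xs n w x - p_ le X x) / p_ le X x|.

End processes.

(* Main.v *)
(* Writing [a] for the empirical process, [B_x] and [C_x] for the sets of elements
   below, resp. comparable to, [x], one has the exact identity
     beta_n(x) = (a(B_x) - tau_x a(C_x)) / (p_x + a(C_x) / sqrt n)
   wherever the denominator is positive. As [p_x >= pbar], the right-hand side
   converges to the continuous linear map
     (L a)(x) = (a(B_x) - tau_x a(C_x)) / p_x,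
   uniformly in [x] and locally uniformly in [a], so the extended continuous
   mapping theorem gives the weak convergence of [beta_n] to [L Z]. That theorem is
   proved without portmanteau: a bounded continuous [g] composed with the n-th map
   is squeezed, for n >= m, between an m-Lipschitz lower and upper envelope of [a],
   both of which converge pointwise to [g (L a)] as m grows. Outer expectations are
   monotone, the envelopes are bounded and continuous, and dominated convergence
   applies to their integrals under the law of [Z].
   The process [L Z] is Gaussian and its covariance follows by bilinearity. The
   one-dimensional limit is obtained by evaluation at [x]; its parameters are read
   off the first two moments. *)
Require Import Defs.
From HB Require Import structures.
From mathcomp Require Import all_boot all_order all_algebra.
From mathcomp Require Import all_classical all_reals all_analysis.
From mathcomp Require Import measurable_realfun ring lra.

Import Order.TTheory GRing.Theory Num.Theory.
Import numFieldNormedType.Exports.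

Local Open Scope classical_set_scope.
Local Open Scope ring_scope.

Set Implicit Arguments.
Unset Strict Implicit.
Unset Printing Implicit Defensive.

(** * The supremum distance on bounded functions *)

Lemma bounded_fun_bound (R : realType) (U : Type) (g : U -> R) : bounded_fun g ->
  exists M : R, forall y, `|g y| <= M.
Proof.
by move=> [M [_ gM]]; exists (M + 1) => y; apply: gM; rewrite // ltrDl.
Qed.

Section linfty_distance.
Context (T : choiceType) (R : realType).
Implicit Types a b c : linfty T R.

Definition supdist a b : R := sup [set `|a t - b t| | t in [set: T]].

Lemma supdist_has_ubound a b : has_ubound [set `|a t - b t| | t in [set: T]].
Proof.
have [M [_ aM]] := linfty_bounded a; have [N [_ bN]] := linfty_bounded b.
exists ((M + 1) + (N + 1)) => _ [t _ <-].
by rewrite (le_trans (ler_normB _ _))// lerD// ?aM ?bN ?ltrDl.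
Qed.

Lemma le_supdist a b t : `|a t - b t| <= supdist a b.
Proof. by apply: ub_le_sup; [exact: supdist_has_ubound|exists t]. Qed.

(** The condition [0 <= e] covers an empty index type, where the supremum is that of the empty set,
    namely 0. *)
Lemma supdist_le a b e : 0 <= e -> (forall t, `|a t - b t| <= e) ->
  supdist a b <= e.
Proof.
move=> e0 abe; rewrite /supdist.
have [->|/set0P ne] := eqVneq [set `|a t - b t| | t in [set: T]] set0.
  by rewrite sup0.
by apply: ge_sup => // _ [t _ <-].
Qed.

Lemma supdist_ge0 a b : 0 <= supdist a b.
Proof.
case/boolP: ([set `|a t - b t| | t in [set: T]] == set0) => [/eqP ab0|/set0P[_ [t _ _]]].
  by rewrite /supdist ab0 sup0.
exact: le_trans (normr_ge0 _) (le_supdist a b t).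
Qed.

Lemma supdistxx a : supdist a a = 0.
Proof.
apply/eqP; rewrite eq_le supdist_ge0 andbT supdist_le// => t.
by rewrite subrr normr0.
Qed.

Lemma supdistC a b : supdist a b = supdist b a.
Proof. by rewrite /supdist; under eq_imagel do rewrite distrC. Qed.

Lemma supdist_triangle b a c : supdist a c <= supdist a b + supdist b c.
Proof.
rewrite supdist_le ?addr_ge0 ?supdist_ge0// => t.
by rewrite -(subrKA (b t)) (le_trans (ler_normD _ _))// lerD ?le_supdist.
Qed.

Lemma linfty_ballE a b (e : R) : ball a e b = forall t, `|a t - b t| < e.
Proof. by []. Qed.

Lemma near_supdist a (e : R) : 0 < e -> \forall b \near a, supdist a b < e.
Proof.
(* Strict pointwise bounds only give a weak bound on the supremum, so the radius is halved. *)
move=> e0; apply/nbhs_ballP; exists (e / 2) => /=; first exact: divr_gt0.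
move=> b; rewrite linfty_ballE => abe; apply: (@le_lt_trans _ _ (e / 2)).
  by rewrite supdist_le ?divr_ge0 ?ltW// => t; exact/ltW/abe.
by rewrite ltr_pdivrMr// ltr_pMr// ltr1n.
Qed.

Lemma nbhs_supdist a (U : set (linfty T R)) : nbhs a U ->
  exists2 e : R, 0 < e & forall b, supdist a b < e -> U b.
Proof.
move=> /nbhs_ballP[e /= e0 aeU]; exists e => // b abe; apply: aeU; rewrite /= linfty_ballE => t.
exact: le_lt_trans (le_supdist a b t) abe.
Qed.

(** The one-sided bound suffices: exchanging [a] and [b] gives the other half, by symmetry of the
    distance. *)
Lemma lipschitz_linfty_continuous (h : linfty T R -> R) (k : R) :
  (forall a b, h a <= h b + k * supdist a b) -> continuous h.
Proof.
move=> hk a; have Fa := nbhs_filter a.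
apply/(@cvgrPdist_lt _ _ _ (nbhs a) Fa h (h a)) => e e0.
near=> b.
have d0 := supdist_ge0 a b.
have kd : `|k| * supdist a b < e.
  (* Enlarging [|k|] by 1 keeps the division below legitimate when [k = 0]. *)
  rewrite (@le_lt_trans _ _ ((`|k| + 1) * supdist a b))//.
    by rewrite ler_wpM2r// lerDl.
  rewrite mulrC -ltr_pdivlMr; last by rewrite ltr_wpDl.
  by near: b; apply: near_supdist; rewrite divr_gt0// ltr_wpDl.
apply: le_lt_trans kd; rewrite ler_norml.
have kle : k * supdist a b <= `|k| * supdist a b.
  by rewrite ler_wpM2r// ler_norm.
have h1 := hk a b; have h2 := hk b a; rewrite supdistC in h2.
by apply/andP; split; lra.
Unshelve. all: by end_near. Qed.

Lemma linfty_eval_continuous (t : T) : continuous (fun a : linfty T R => a t).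
Proof.
apply: (@lipschitz_linfty_continuous _ 1) => a b; rewrite mul1r.
by rewrite -lerBlDl (le_trans _ (le_supdist a b t))// ler_norm.
Qed.

End linfty_distance.

(** * Lipschitz envelopes along a sequence of multivalued maps *)

Section envelope.
Context (T : choiceType) (R : realType) (F : topologicalType) (W : Type).
Context (A : nat -> W -> linfty T R) (B : nat -> W -> F).
Context (L : linfty T R -> F).

(* The hypothesis [g_n(a_n) --> L a] of the extended continuous mapping theorem,
   for the multivalued maps [g_n] sending [A n w] to [B n w]. *)
Definition asymptotic_image := forall a U, nbhs (L a) U ->
  exists2 e : R, 0 < e & \forall n \near \oo, forall w,
    supdist a (A n w) < e -> U (B n w).

Context (Lcont : continuous L).
Context (ABL : asymptotic_image).
Context (g : F -> R) (M : R).
Context (gcont : continuous g).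
Context (gM : forall y, `|g y| <= M).

Let tail m : set (linfty T R * F) :=
  [set z | z.2 = L z.1 \/
    exists n w, [/\ (m <= n)%N, z.1 = A n w & z.2 = B n w]].

Let vals m a := [set g z.2 + m%:R * supdist a z.1 | z in tail m].

(* Pasch-Hausdorff envelope: the largest [m]-Lipschitz function below [g] on the
   tail [n >= m] of the multivalued maps and on the graph of [L]. *)
Definition lower_envelope (m : nat) (a : linfty T R) : R := inf (vals m a).

Let vals_lb m a : lbound (vals m a) (- M).
Proof.
move=> _ [z _ <-]; rewrite -[leLHS]addr0 lerD ?mulr_ge0 ?supdist_ge0//.
by have := gM z.2; rewrite ler_norml => /andP[].
Qed.

Let vals_has_inf m a : has_inf (vals m a).
Proof.
split; last by exists (- M); exact: vals_lb.
by exists (g (L a) + m%:R * supdist a a), (a, L a) => //; left.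
Qed.

Let env_le m a z : tail m z ->
  lower_envelope m a <= g z.2 + m%:R * supdist a z.1.
Proof. by move=> mz; apply: ge_inf; [case: (vals_has_inf m a)|exists z]. Qed.

Let env_ge m a c :
  (forall z, tail m z -> c <= g z.2 + m%:R * supdist a z.1) ->
  c <= lower_envelope m a.
Proof.
move=> h; apply: lb_le_inf; first by case: (vals_has_inf m a).
by move=> _ [z mz <-]; exact: h.
Qed.

Lemma lower_envelope_le_lim m a : lower_envelope m a <= g (L a).
Proof.
have := @env_le m a (a, L a) (or_introl erefl).
by rewrite supdistxx mulr0 addr0.
Qed.

Lemma lower_envelope_le m n w : (m <= n)%N ->
  lower_envelope m (A n w) <= g (B n w).
Proof.
move=> mn; have := @env_le m (A n w) (A n w, B n w).
by rewrite supdistxx mulr0 addr0; apply; right; exists n, w.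
Qed.

Lemma lower_envelope_bounded m a : `|lower_envelope m a| <= M.
Proof.
rewrite ler_norml; apply/andP; split.
  by apply: lb_le_inf; [case: (vals_has_inf m a)|exact: vals_lb].
by rewrite (le_trans (lower_envelope_le_lim m a))// (le_trans _ (gM (L a)))// ler_norm.
Qed.

Lemma lower_envelope_continuous m : continuous (lower_envelope m).
Proof.
apply: (@lipschitz_linfty_continuous _ _ _ m%:R) => a b.
rewrite -lerBlDr; apply: env_ge => z mz; rewrite lerBlDr.
rewrite (le_trans (env_le a mz))// -addrA lerD2l -mulrDr ler_wpM2l//.
by rewrite addrC (supdist_triangle b).
Qed.

(** Points of the tail within distance [d] of [a] have values of [g] at least [g (L a) - e], by
    continuity of [g] and [L] on the graph and by [asymptotic_image] on the sequence. Points farther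
    away pay a penalty [m * d], which for large [m] exceeds [2 * M], a bound on the oscillation of
    [g]. *)
Lemma cvg_lower_envelope a : lower_envelope m a @[m --> \oo] --> g (L a).
Proof.
apply/cvgrPdist_le => e e0.
have [d1 d10 near1] : exists2 d : R, 0 < d &
    forall b, supdist a b < d -> g (L a) - e <= g (L b).
  have : \forall b \near a, `|g (L a) - g (L b)| < e.
    have /cvgrPdist_lt : g (L b) @[b --> a] --> g (L a).
      by apply: (cvg_comp L g); [exact: Lcont|exact: gcont].
    exact.
  move=> /nbhs_supdist[d d0 h]; exists d => // b /h.
  by rewrite ltr_distlC => /andP[/ltW].
have [d2 d20 near2] : exists2 d : R, 0 < d & \forall n \near \oo, forall w,
    supdist a (A n w) < d -> g (L a) - e <= g (B n w).
  have [|d d0 h] := @ABL a [set y | g (L a) - e <= g y].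
    have /cvgrPdist_lt/(_ _ e0) := @gcont (L a).
    by apply: filterS => y /=; rewrite ltr_distlC => /andP[/ltW].
  by exists d.
pose d := Num.min d1 d2; have d0 : 0 < d by rewrite lt_min d10 d20.
case: near2 => N _ near2.
near=> m.
have Nm : (N <= m)%N by near: m; exact: nbhs_infty_ge.
have Mm : 2 * M <= m%:R * d.
  by rewrite -ler_pdivrMr//; near: m; exact: nbhs_infty_ger.
rewrite ger0_norm ?subr_ge0 ?lower_envelope_le_lim// lerBlDr -lerBlDl.
apply: env_ge => z mz; have [zd|dz] := ltP (supdist a z.1) d.
  rewrite -[leLHS]addr0 lerD ?mulr_ge0 ?supdist_ge0//.
  move: zd; rewrite lt_min => /andP[zd1 zd2].
  case: mz zd1 zd2 => [->|[n [w [mn -> ->]]]] zd1 zd2; first exact: near1.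
  exact: near2 (leq_trans Nm mn) _ zd2.
have : m%:R * d <= m%:R * supdist a z.1 by rewrite ler_wpM2l.
have := gM z.2; have := gM (L a); rewrite !ler_norml => /andP[_ ?] /andP[? _] ?.
lra.
Unshelve. all: by end_near. Qed.

End envelope.

(** The limits are taken one after the other: first a single [m] is fixed with both [a m] and [b m]
    close to [l], then [n] goes to infinity for that [m]. *)
Lemma cvge_squeeze_sup_inf (R : realType) (u : nat -> \bar R) (l : R)
    (lo up : nat -> nat -> \bar R) (a b : nat -> R) :
  (forall m, lo m n @[n --> \oo] --> (a m)%:E) -> a m @[m --> \oo] --> l ->
  (forall m, up m n @[n --> \oo] --> (b m)%:E) -> b m @[m --> \oo] --> l ->
  (forall m n, (m <= n)%N -> (lo m n <= u n <= up m n)%E) ->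
  u n @[n --> \oo] --> l%:E.
Proof.
move=> loa al upb bl loup.
have key e : 0 < e ->
    \forall n \near \oo, ((l - e)%:E <= u n <= (l + e)%:E)%E.
  move=> e0; have e20 : 0 < e / 2 by exact: divr_gt0.
  have [m [am bm]] : exists m, `|l - a m| < e / 2 /\ `|l - b m| < e / 2.
    have [N _ HN] : \forall m \near \oo, `|l - a m| < e / 2 /\ `|l - b m| < e / 2.
      by near=> m; split; near: m; [move/cvgrPdist_lt : al|move/cvgrPdist_lt : bl]; exact.
    by exists N; exact: (HN N (leqnn N)).
  have /fine_cvgP[flo /cvgrPdist_lt/(_ _ e20) clo] := loa m.
  have /fine_cvgP[fup /cvgrPdist_lt/(_ _ e20) cup] := upb m.
  near=> n.
  have /(loup _)/andP[lou uup] : (m <= n)%N by near: n; exact: nbhs_infty_ge.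
  apply/andP; split.
    apply: (le_trans _ lou).
    have nfin : lo m n \is a fin_num by near: n.
    have nd : `|a m - fine (lo m n)| < e / 2 by near: n.
    rewrite -(fineK nfin) lee_fin.
    by move: am nd; rewrite !ltr_norml => /andP[? ?] /andP[? ?]; lra.
  apply: (le_trans uup).
  have nfin : up m n \is a fin_num by near: n.
  have nd : `|b m - fine (up m n)| < e / 2 by near: n.
  rewrite -(fineK nfin) lee_fin.
  by move: bm nd; rewrite !ltr_norml => /andP[? ?] /andP[? ?]; lra.
(* The squeeze with tolerance 1 makes [u] eventually finite, which reduces the claim to convergence
   of reals. *)
have fin_u : \forall n \near \oo, u n \is a fin_num.
  apply: filterS (key 1 ltr01) => n /andP[lu ul].
  by rewrite fin_numElt (lt_le_trans _ lu) ?ltNyr// (le_lt_trans ul) ?ltry.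
apply: cvg_EFin => //; apply/cvgrPdist_le => e e0.
near=> n.
have : ((l - e)%:E <= u n <= (l + e)%:E)%E by near: n; exact: key.
have nfin : u n \is a fin_num by near: n.
rewrite -(fineK nfin) /= !lee_fin ler_norml => /andP[? ?].
by apply/andP; split; lra.
Unshelve. all: by end_near. Qed.

(** * Outer expectations and Borel measurability *)

Section outer_expectation.
Context d (W : measurableType d) (R : realType) (P : probability W R).

Lemma le_outer_expectation (H H' : W -> R) : (forall w, H w <= H' w) ->
  (outer_expectation P H <= outer_expectation P H')%E.
Proof.
move=> HH'; apply: le_ereal_inf => _ [U [iU H'U] <-].
exists U => //; split => // w; apply: le_trans (H'U w).
by rewrite lee_fin.
Qed.

Lemma bounded_measurable_integrable (H : W -> R) (M : R) :
  measurable_fun setT H -> (forall w, `|H w| <= M) ->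
  P.-integrable setT (EFin \o H).
Proof.
move=> mH HM; apply: measurable_bounded_integrable => //.
  by rewrite -ge0_fin_numE// fin_num_measure.
exact: bounded_fun_le HM.
Qed.

(** Such an [H] is integrable, hence its own least integrable majorant, and the infimum is attained
    at it. *)
Lemma outer_expectation_measurable (H : W -> R) (M : R) :
  measurable_fun setT H -> (forall w, `|H w| <= M) ->
  outer_expectation P H = (\int[P]_w (H w)%:E)%E.
Proof.
move=> mH HM; have iH := bounded_measurable_integrable mH HM.
apply/eqP; rewrite eq_le; apply/andP; split.
  by apply: ereal_inf_lbound; exists (EFin \o H).
by apply/ereal_infP => _ [U [iU HU] <-]; apply: le_integral.
Qed.

End outer_expectation.

Section borel.
Context d (W : measurableType d) (R : realType).

(** Real targets are treated apart because [R] carries its own sigma-algebra instead of [borel R];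
    it is generated by open intervals. *)
Lemma continuous_borel_measurable (E : ptopologicalType) (h : E -> R)
    (Z : W -> E) : continuous h -> measurable_fun setT (Z : W -> borel E) ->
  measurable_fun setT (h \o Z).
Proof.
move=> /continuousP hc mZ.
apply: (measurability _ (RGenOpens.measurableE R)).
move=> _ [_ [a [b ->]] <-]; rewrite comp_preimage; apply: mZ => //.
by apply: sub_sigma_algebra; apply: hc; exact: interval_open.
Qed.

Lemma continuous_borel (E F : ptopologicalType) (h : E -> F) (Z : W -> E) :
  continuous h -> measurable_fun setT (Z : W -> borel E) ->
  measurable_fun setT (h \o Z : W -> borel F).
Proof.
move=> /continuousP hc mZ.
apply: (@measurability _ _ W (borel F) setT (h \o Z) (@open F)) => //.
move=> _ [U oU <-].
rewrite comp_preimage; apply: mZ => //.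
by apply: sub_sigma_algebra; exact: hc.
Qed.

End borel.

(** * The extended continuous mapping theorem *)

Section extended_continuous_mapping.
Context (T : choiceType) (R : realType) (F : ptopologicalType).
Context d (W : measurableType d) (P : probability W R).
Context d' (W' : measurableType d') (Q : probability W' R).

Lemma weak_cvg_asymptotic_image (A : nat -> W -> linfty T R)
    (B : nat -> W -> F) (L : linfty T R -> F) (Z : W' -> linfty T R) :
  continuous L -> asymptotic_image A B L ->
  weak_cvg P A Q Z -> weak_cvg P B Q (L \o Z).
Proof.
move=> Lc ABL [mZ AZ]; split; first exact: continuous_borel.
move=> g gc /bounded_fun_bound[M gM].
have Ngc : continuous (fun y => - g y).
  by move=> y; apply: cvgN; exact: gc.
have NgM y : `|- g y| <= M by rewrite normrN.
pose lo m := lower_envelope A B L g m.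
(* The upper envelope of [g] is obtained from the lower one by a change of sign. *)
pose up m a := - lower_envelope A B L (fun y => - g y) m a.
have loc m : continuous (lo m) by exact: (lower_envelope_continuous gM).
have upc m : continuous (up m).
  move=> a; apply: (@cvgN _ _ _ (nbhs a) (nbhs_filter a)).
  exact: (lower_envelope_continuous NgM).
have loM m a : `|lo m a| <= M by exact: lower_envelope_bounded.
have upM m a : `|up m a| <= M.
  by rewrite normrN; exact: lower_envelope_bounded.
have lol a : lo m a @[m --> \oo] --> g (L a).
  exact: (cvg_lower_envelope Lc ABL gc gM).
have upl a : up m a @[m --> \oo] --> g (L a).
  rewrite -[g (L a)]opprK; apply: cvgN.
  exact: (cvg_lower_envelope Lc ABL Ngc NgM).
have integrable_bounded h : continuous h -> (forall a, `|h a| <= M) ->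
    Q.-integrable setT (fun w => (h (Z w))%:E).
  move=> hc hM; apply: (@bounded_measurable_integrable _ _ _ _ _ M) => //.
  exact: continuous_borel_measurable.
pose I (h : linfty T R -> R) := fine (\int[Q]_w (h (Z w))%:E).
have intE h : continuous h -> (forall a, `|h a| <= M) ->
    (\int[Q]_w (h (Z w))%:E = (I h)%:E)%E.
  by move=> hc hM; rewrite /I fineK// integrable_fin_num// integrable_bounded.
have Icvg (h : nat -> linfty T R -> R) : (forall m, continuous (h m)) ->
    (forall m a, `|h m a| <= M) ->
    (forall a, h m a @[m --> \oo] --> g (L a)) ->
    I (h m) @[m --> \oo] --> I (g \o L).
  move=> hc hM hl; apply: fine_cvg.
  rewrite /I fineK; last first.
    apply: integrable_fin_num => //; apply: integrable_bounded.
      by move=> a; apply: (cvg_comp L g); [exact: Lc|exact: gc].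
    by move=> a; exact: gM.
  apply: (@dominated_cvg _ _ _ Q setT measurableT _ _ (cst M%:E)).
  - move=> m; apply/measurable_EFinP; exact: continuous_borel_measurable.
  - move=> w _; apply: cvg_EFin; first by apply: nearW => m.
    exact: hl.
  - by [].
  - exact: finite_measure_integrable_cst.
  - by move=> m w _; rewrite lee_fin.
have gLc : continuous (g \o L).
  by move=> a; apply: (cvg_comp L g); [exact: Lc|exact: gc].
rewrite (intE (g \o L) gLc (fun a => gM (L a))).

(* For fixed [m], the limit in [n] is the weak convergence of [A] tested on a continuous bounded
   envelope; the limit in [m] is dominated convergence under [Q]. *)
apply: (@cvge_squeeze_sup_inf _ _ _
  (fun m n => outer_expectation P (lo m \o A n))
  (fun m n => outer_expectation P (up m \o A n))
  (fun m => I (lo m)) (fun m => I (up m))).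
- by move=> m; rewrite -intE//; apply: AZ => //; exact: bounded_fun_le (loM m).
- exact: Icvg.
- by move=> m; rewrite -intE//; apply: AZ => //; exact: bounded_fun_le (upM m).
- exact: Icvg.
- move=> m n mn; apply/andP; split; apply: le_outer_expectation => w /=.
    exact: lower_envelope_le.
  by rewrite lerNr; exact: lower_envelope_le.
Qed.

End extended_continuous_mapping.

(* The denominator [p + v / s] is the empirical probability of the class when
   [s = sqrt n], [p] is the probability and [v] the empirical process. *)
Lemma ratio_linearization (R : realType) (u v t p q K s : R) :
  0 < q -> q <= p -> 0 < s -> `|u| <= K -> `|v| <= K -> `|t| <= 1 ->
  2 * K <= q * s ->
  `|(u - t * v) / (p + v / s) - (u - t * v) / p| <= 4 * K ^+ 2 / (q ^+ 2 * s).
Proof.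
move=> q0 qp s0 uK vK t1 Kqs.
have p0 : 0 < p by exact: lt_le_trans qp.
have K0 : 0 <= K by exact: le_trans uK.
have vs : `|v / s| <= q / 2.
  rewrite normrM normfV (gtr0_norm s0) ler_pdivrMr//.
  by rewrite (le_trans vK)// mulrAC ler_pdivlMr// mulrC.
have den : q / 2 <= p + v / s.
  by move: vs; rewrite ler_norml => /andP[? ?]; lra.
have den0 : 0 < p + v / s by apply: lt_le_trans den; rewrite divr_gt0.
(* In this form the numerator is at most [2 * K ^ 2 / s] and the denominator at least [q * (q / 2)],
   whence the constant 4. *)
have -> : (u - t * v) / (p + v / s) - (u - t * v) / p =
    - ((u - t * v) * v / s / (p * (p + v / s))).
  by rewrite -(mulrA _ v); move: (v / s) den0 => r den0; field; rewrite !gt_eqF.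
rewrite normrN normrM normfV (gtr0_norm (mulr_gt0 p0 den0)).
rewrite ler_pdivrMr ?mulr_gt0//.
have num : `|(u - t * v) * v / s| <= 2 * K * K / s.
  rewrite normrM normfV (gtr0_norm s0) ler_pM2r ?invr_gt0// normrM.
  apply: ler_pM => //; rewrite (le_trans (ler_normB _ _))// normrM.
  rewrite [2]/(1 + 1) mulrDl mul1r lerD// (le_trans _ vK)// ler_piMl//.
apply: (le_trans num).
apply: (@le_trans _ _ (4 * K ^+ 2 / (q ^+ 2 * s) * (q * (q / 2)))).
  by rewrite le_eqVlt; apply/orP; left; apply/eqP; field; rewrite !gt_eqF.
apply: ler_wpM2l; first by rewrite divr_ge0// mulr_ge0 ?sqr_ge0 ?ltW// exprn_ge0.
by apply: ler_pM => //; rewrite ?divr_ge0 ?ltW.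
Qed.

(** * The linearized map and the uniform remainder *)

Section delta_method.
Context d d' (W : measurableType d) (S : measurableType d') (R : realType)
  (P : probability W R) (le : rel S) (X : {RV P >-> S})
  (Xs : nat -> {RV P >-> S})
  (mbelow : forall x, measurable (below le x))
  (mabove : forall x, measurable (above le x))
  (pbar : R) (pbar_gt0 : 0 < pbar).

Local Notation p := (p_ le X).
Local Notation tau := (tau le X).

Definition below_class x : order_class le :=
  exist _ (below le x) (mem_set (ex_intro _ x (Or32 _ _ erefl))).

Definition comparables_class x : order_class le :=
  exist _ (comparables le x) (mem_set (ex_intro _ x (Or31 _ _ erefl))).

Lemma below_comparables x : below le x `&` comparables le x = below le x.
Proof. by apply: setIidl => y; rewrite /below/comparables/= => ->; rewrite orbT. Qed.

Lemma Pr_below x : C_ge le X pbar x -> Pr X (below le x) = tau x * p x.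
Proof.
move=> px; rewrite /Defs.tau below_comparables divfK//.
by rewrite gt_eqF// (lt_le_trans pbar_gt0).
Qed.

Definition delta_fun (a : linfty (order_class le) R) (x : C_ge le X pbar) : R :=
  (a (below_class (val x)) - tau (val x) * a (comparables_class (val x)))
  / p (val x).

Lemma C_geP (x : C_ge le X pbar) : pbar <= p (val x).
Proof. by have /set_mem := valP x. Qed.

(** Stated for a bare function [a], so as to serve both for the boundedness of one image and,
    applied to a pointwise difference, for the Lipschitz estimate. The factor 2 comes from
    [|tau| <= 1]. *)
Lemma delta_fun_bound (a : order_class le -> R) (K : R) :
  (forall A, `|a A| <= K) -> forall x : C_ge le X pbar,
  `|(a (below_class (val x)) - tau (val x) * a (comparables_class (val x)))
  / p (val x)| <= 2 * K / pbar.
Proof.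
move=> aK x; have px := C_geP x; have p0 := lt_le_trans pbar_gt0 px.
have K0 : 0 <= K := le_trans (normr_ge0 _) (aK (below_class (val x))).
rewrite normrM normfV (gtr0_norm p0) ler_pM ?invr_ge0 ?(ltW p0)//; last first.
  by rewrite lef_pV2.
rewrite (le_trans (ler_normB _ _))// [2]/(1 + 1) mulrDl mul1r lerD// normrM.
by rewrite (le_trans _ (aK (comparables_class (val x))))// ler_piMl// tau_norm.
Qed.

Lemma delta_fun_bounded a : bounded_fun (delta_fun a).
Proof.
have [K aK] := bounded_fun_bound (linfty_bounded a).
exact: bounded_fun_le (delta_fun_bound aK).
Qed.

Definition delta_map a : linfty (C_ge le X pbar) R := Linfty (delta_fun_bounded a).

Lemma delta_map_lipschitz a b :
  supdist (delta_map a) (delta_map b) <= 2 * supdist a b / pbar.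
Proof.
apply: supdist_le.
  by rewrite divr_ge0 ?(ltW pbar_gt0)// mulr_ge0// supdist_ge0.
move=> x /=; apply: le_trans (delta_fun_bound (le_supdist a b) x).
by rewrite le_eqVlt; apply/orP; left; apply/eqP; congr `|_|; rewrite /delta_fun; ring.
Qed.

Lemma delta_map_continuous : continuous delta_map.
Proof.
move=> a U /nbhs_supdist[e e0 aeU].
have : \forall b \near a, supdist a b < e * pbar / 2.
  by apply: near_supdist; rewrite divr_gt0// mulr_gt0.
apply: filterS => b ab; apply: aeU.
rewrite (le_lt_trans (delta_map_lipschitz a b))//.
by rewrite ltr_pdivrMr// mulrC -ltr_pdivlMr.
Qed.

Local Notation alpha := (alpha X Xs mbelow mabove).
Local Notation beta := (beta X Xs mbelow mabove pbar).

(** The denominator equals the empirical probability of the comparables, so its positivity selects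
    the quotient branch of [Pn_cond]. In the numerator the centring terms cancel, as the probability
    of the lower set is [tau * p]. *)
Lemma beta_alpha n w x (s := Num.sqrt n%:R) :
  0 < s -> 0 < p (val x) + alpha n w (comparables_class (val x)) / s ->
  beta n w x =
  (alpha n w (below_class (val x))
   - tau (val x) * alpha n w (comparables_class (val x)))
  / (p (val x) + alpha n w (comparables_class (val x)) / s).
Proof.
move=> s0; rewrite /beta/= -/s => den0.
have PnC : Pn Xs n w (comparables le (val x)) =
    p (val x) + s * (Pn Xs n w (comparables le (val x))
                     - Pr X (comparables le (val x))) / s.
  by rewrite mulrAC divff ?gt_eqF// mul1r /p_ subrKC.
rewrite -PnC in den0 *.
rewrite /tau_hat /Pn_cond den0 below_comparables Pr_below; last exact: C_geP.
rewrite /p_ /= in den0 *.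
by field; rewrite gt_eqF.
Qed.

Lemma beta_asymptotic_image : asymptotic_image alpha beta delta_map.
Proof.
move=> a U /nbhs_supdist[e e0 aeU].
have [K aK] := bounded_fun_bound (linfty_bounded a).
(* The bound 1 keeps [alpha n w] below [K1] in absolute value; the bound [e * pbar / 8], through the
   Lipschitz constant [2 / pbar], moves the image by at most [e / 4]. *)
exists (Num.min 1 (e * pbar / 8)).
  by rewrite lt_min ltr01 divr_gt0// mulr_gt0.
pose K1 := `|K| + 1.
have sqrty (c : R) : \forall n \near \oo, c <= Num.sqrt n%:R.
  near=> n; rewrite (le_trans (ler_norm c))// -sqrtr_sqr ler_wsqrtr//.
  by near: n; exact: nbhs_infty_ger.
near=> n => w; rewrite lt_min => /andP[d1 de].
pose s : R := Num.sqrt n%:R.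
have s0 : 0 < s by rewrite sqrtr_gt0 ltr0n; near: n; exists 1%N.
(* The first threshold keeps the random denominator above [pbar / 2]; the second makes the
   linearization error at most [e / 4]. *)
have sK : 2 * K1 / pbar <= s by rewrite /s; near: n; exact: sqrty.
have sr : 4 * K1 ^+ 2 / pbar ^+ 2 / (e / 4) <= s.
  by rewrite /s; near: n; exact: sqrty.
have alphaK A : `|alpha n w A| <= K1.
  rewrite -[alpha n w A](subrKC (a A)) (le_trans (ler_normD _ _))// lerD//.
    by rewrite (le_trans (aK A))// ler_norm.
  by rewrite distrC (le_trans (le_supdist _ _ A))// ltW.
have rem : supdist (delta_map (alpha n w)) (beta n w) <= e / 4.
  apply: supdist_le; first by rewrite ltW// divr_gt0.
  move=> x; have Kqs : 2 * K1 <= pbar * s.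
    by rewrite [leRHS]mulrC -ler_pdivrMr.
  rewrite distrC beta_alpha//.
    rewrite (le_trans (ratio_linearization pbar_gt0 (C_geP x) s0 _ _ _ Kqs))//.
      exact: tau_norm.
    by rewrite invfM mulrA ler_pdivrMr// [leRHS]mulrC -ler_pdivrMr ?divr_gt0.
  rewrite -/s.
  have : `|alpha n w (comparables_class (val x)) / s| <= pbar / 2.
    rewrite normrM normfV (gtr0_norm s0) ler_pdivrMr//.
    by rewrite (le_trans (alphaK _))// mulrAC ler_pdivlMr// mulrC.
  rewrite ler_norml => /andP[lo _]; apply: lt_le_trans (lerD (C_geP x) lo).
  by rewrite subr_gt0 ltr_pdivrMr// ltr_pMr// ltr1n.
apply: aeU; rewrite (le_lt_trans (supdist_triangle (delta_map (alpha n w)) _ _))//.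
have : supdist (delta_map a) (delta_map (alpha n w)) <= e / 4.
  rewrite (le_trans (delta_map_lipschitz _ _))// ler_pdivrMr//.
  by lra.
by lra.
Unshelve. all: by end_near. Qed.

End delta_method.

(** * Mean and variance of the normal density *)

Section normal_moments.
Context (R : realType).
Local Notation mu := (@lebesgue_measure R).

(* The truncation to symmetric intervals is removed by dominated convergence,
   hence the a priori integrability of the derivative. *)
Lemma integral_derivative_line (f F : R -> R) (m l : R) :
  continuous f -> (forall x : R, is_derive x 1 F (f x)) ->
  mu.-integrable setT (EFin \o f) ->
  F (m + n%:R) - F (m - n%:R) @[n --> \oo] --> l ->
  (\int[mu]_x (f x)%:E = l%:E)%E.
Proof.
move=> cf dF intf Fl.
(* The shift to [n.+1] makes every interval nondegenerate, as the fundamental theorem of calculus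
   requires. *)
pose D n : set R := `[m - n.+1%:R, m + n.+1%:R]%classic.
have intD n : (\int[mu]_(x in D n) (f x)%:E)%E =
    (F (m + n.+1%:R) - F (m - n.+1%:R))%:E.
  have mm : m - n.+1%:R < m + n.+1%:R by rewrite ltrD2l gtrN// ltr0n.
  have cF : continuous F.
    by move=> x; apply/differentiable_continuous/derivable1_diffP; apply: ex_derive.
  rewrite (continuous_FTC2 (F := F) mm) //.
  - exact: continuous_subspaceT.
  - split.
    + by move=> x _; apply: ex_derive.
    + by apply: cvg_at_right_filter; exact: cF.
    + by apply: cvg_at_left_filter; exact: cF.
  - by move=> x _; rewrite derive1E derive_val.
have lim1 : (\int[mu]_(x in D n) (f x)%:E)%E @[n --> \oo] --> l%:E.
  under eq_fun do rewrite intD.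
  apply: cvg_EFin; first by apply: nearW.
  have := Fl; rewrite -(cvg_shiftS (fun n => F (m + n%:R) - F (m - n%:R))).
  by apply.
have lim2 : (\int[mu]_(x in D n) (f x)%:E)%E @[n --> \oo] -->
    (\int[mu]_x (f x)%:E)%E.
  under eq_fun do rewrite integral_mkcond.
  apply: (@dominated_cvg _ _ _ mu setT measurableT _ _ (fun x => `|(f x)%:E|)%E).
  - move=> n; apply/(measurable_restrictT (EFin \o f)) => //.
      exact: measurable_itv.
    exact: measurable_funTS (measurable_int mu intf).
  - move=> x _; apply: cvg_near_cst; near=> n; rewrite patchE ifT// inE /D/= in_itv/=.
    have xn : `|x - m| <= n.+1%:R.
      rewrite (@le_trans _ _ n%:R) ?ler_nat//; near: n; exact: nbhs_infty_ger.
    by move: xn; rewrite ler_distl.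
  - by [].
  - exact: integrable_abse.
  - by move=> n x _; rewrite patchE; case: ifP => //; rewrite abse0.
exact: cvg_unique lim2 lim1.
Unshelve. all: by end_near. Qed.

Context (m s : R).
Context (s0 : s != 0).
Local Notation phi := (normal_pdf m s).

Lemma is_derive_normal_pdf (x : R) :
  is_derive x 1 phi (- (x - m) / s ^+ 2 * phi x).
Proof.
rewrite normal_pdfE//.
have d1 : is_derive x 1 (fun y : R => - (y - m) ^+ 2 / (s ^+ 2 *+ 2))
    (- (x - m) / s ^+ 2).
  apply: is_derive_eq; rewrite /GRing.scale/=.
  by field.
apply: is_derive_eq; rewrite /GRing.scale /= /normal_fun.
by ring.
Qed.

Lemma normal_pdf_sym (t : R) : phi (m - t) = phi (m + t).
Proof.
have sqE : (m - t - m) ^+ 2 = (m + t - m) ^+ 2 by ring.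
by rewrite normal_pdfE// /normal_fun sqE.
Qed.

(** With [u = n ^ 2 / (2 * s ^ 2)], the inequality [1 + u <= expR u] gives [expR (- u) <= 1 / u], so
    the sequence is at most [c / n], where [c] is the peak times [2 * s ^ 2]. *)
Lemma cvg_nat_normal_pdf : n%:R * phi (m + n%:R) @[n --> \oo] --> (0 : R).
Proof.
apply/cvgrPdist_le => e e0.
pose c := normal_peak s * (s ^+ 2 *+ 2).
near=> n; have n0 : 0 < n%:R :> R by rewrite ltr0n; near: n; exists 1%N.
rewrite sub0r normrN ger0_norm ?mulr_ge0 ?normal_pdf_ge0//.
have s20 : 0 < s ^+ 2 *+ 2 by rewrite mulrn_wgt0// exprn_even_gt0.
apply: (@le_trans _ _ (c / n%:R)); last first.
  rewrite ler_pdivrMr// -ler_pdivrMl// mulrC.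
  by near: n; exact: nbhs_infty_ger.
rewrite ler_pdivlMr// normal_pdfE// /normal_fun /c.
rewrite mulrAC -expr2 mulrCA ler_wpM2l ?normal_peak_ge0//.
rewrite (_ : m + n%:R - m = n%:R); last by rewrite addrAC subrr add0r.
rewrite mulNr expRN ler_pdivrMr ?expR_gt0// mulrC -ler_pdivrMr//.
by rewrite (le_trans _ (expR_ge1Dx _))// lerDr.
Unshelve. all: by end_near. Qed.

(** The function [(x - m) * phi x] has the primitive [- s ^ 2 * phi], which takes equal values at
    [m + n] and [m - n]. *)
Lemma normal_pdf_mean : mu.-integrable setT (fun x => (x * phi x)%:E) ->
  (\int[mu]_x (x * phi x)%:E = m%:E)%E.
Proof.
move=> intx; have intphi := integrable_normal_pdf m s.
have intmphi : mu.-integrable setT (fun x => m%:E * (phi x)%:E)%E.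
  exact: integrableZl.
have E x : ((x - m) * phi x)%:E = ((x * phi x)%:E - m%:E * (phi x)%:E)%E.
  by rewrite -EFinM -EFinB mulrBl.
have int1 : mu.-integrable setT (EFin \o (fun x => (x - m) * phi x)).
  rewrite (_ : _ \o _ = (fun x => (x * phi x)%:E - m%:E * (phi x)%:E)%E).
    exact: integrableB.
  by apply/funext => x; exact: E.
have : (\int[mu]_x ((x - m) * phi x)%:E = 0%:E)%E.
  apply: (@integral_derivative_line (fun x => (x - m) * phi x)
    (fun x => - s ^+ 2 * phi x) m 0 _ _ int1).
  - move=> x; apply: cvgM; last exact: continuous_normal_pdf.
    by apply: cvgB; [exact: cvg_id|exact: cvg_cst].
  - move=> x; have dphi := is_derive_normal_pdf x.
    by apply: is_derive_eq; rewrite /GRing.scale/=; field.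
  - under eq_fun do rewrite normal_pdf_sym subrr.
    exact: cvg_cst.
under eq_integral do rewrite E.
rewrite integralB// integralZl// integral_normal_pdf mule1.
move=> /eqP; rewrite sube_eq.
  by rewrite add0e => /eqP.
  exact: integrable_fin_num.
by [].
Qed.

(** Subtracting [s ^ 2 * phi], of integral [s ^ 2], leaves a function with primitive
    [- s ^ 2 * ((x - m) * phi x)], whose boundary values vanish in the limit. *)
Lemma normal_pdf_variance :
  mu.-integrable setT (fun x => ((x - m) ^+ 2 * phi x)%:E) ->
  (\int[mu]_x ((x - m) ^+ 2 * phi x)%:E = (s ^+ 2)%:E)%E.
Proof.
move=> intx; have intphi := integrable_normal_pdf m s.
have intmphi : mu.-integrable setT (fun x => (s ^+ 2)%:E * (phi x)%:E)%E.
  exact: integrableZl.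
have E x : (((x - m) ^+ 2 - s ^+ 2) * phi x)%:E =
    (((x - m) ^+ 2 * phi x)%:E - (s ^+ 2)%:E * (phi x)%:E)%E.
  by rewrite -EFinM -EFinB mulrBl.
have int1 : mu.-integrable setT
    (EFin \o (fun x => ((x - m) ^+ 2 - s ^+ 2) * phi x)).
  rewrite (_ : _ \o _ =
      (fun x => ((x - m) ^+ 2 * phi x)%:E - (s ^+ 2)%:E * (phi x)%:E)%E).
    exact: integrableB.
  by apply/funext => x; exact: E.
have : (\int[mu]_x (((x - m) ^+ 2 - s ^+ 2) * phi x)%:E = 0%:E)%E.
  apply: (@integral_derivative_line (fun x => ((x - m) ^+ 2 - s ^+ 2) * phi x)
    (fun x => - s ^+ 2 * ((x - m) * phi x)) m 0 _ _ int1).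
  - move=> x; apply: cvgM; last exact: continuous_normal_pdf.
    apply: cvgB; last exact: cvg_cst.
    apply: (cvg_comp (fun x => x - m) (fun x => x ^+ 2)); last exact: sqr_continuous.
    by apply: cvgB; [exact: cvg_id|exact: cvg_cst].
  - move=> x; have dphi := is_derive_normal_pdf x.
    by apply: is_derive_eq; rewrite /GRing.scale/=; field.
  - rewrite (_ : (fun n => _) =
        (fun n => - s ^+ 2 * 2 * (n%:R * phi (m + n%:R)))); last first.
      by apply/funext => n; rewrite normal_pdf_sym; ring.
    rewrite -[X in _ --> X](mulr0 (- s ^+ 2 * 2)).
    by apply: cvgM; [exact: cvg_cst|exact: cvg_nat_normal_pdf].
under eq_integral do rewrite E.
rewrite integralB// integralZl// integral_normal_pdf mule1.
move=> /eqP; rewrite sube_eq.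
  by rewrite add0e => /eqP.
  exact: integrable_fin_num.
by [].
Qed.

End normal_moments.

(** * Reading the parameters of a normal law off its moments *)

Section normal_law.
Context (R : realType).
Local Notation mu := (@lebesgue_measure R).

(** The Radon-Nikodym derivative agrees almost everywhere with the normal density, since both have
    the same integral over every measurable set. *)
Lemma integral_normal_prob (m s : R) (f : R -> \bar R) :
  (normal_prob m s).-integrable setT f ->
  (\int[normal_prob m s]_x f x = \int[mu]_x (f x * (normal_pdf m s x)%:E))%E.
Proof.
move=> intf; have mf := measurable_int (normal_prob m s) intf.
rewrite -(Radon_Nikodym_change_of_variables (normal_prob_dominates m s))//=.
apply: ae_eq_integral => //.
- apply: emeasurable_funM => //; apply: (measurable_int mu).
  by apply: Radon_Nikodym_integrable; exact: normal_prob_dominates.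
- apply: emeasurable_funM => //=; apply/measurable_EFinP.
  exact: measurable_normal_pdf.
- apply: ae_eqe_mul2l => /=.
  rewrite Radon_NikodymE//=; first exact: normal_prob_dominates.
  move=> nmu; case: cid => /= h [h1 h2 h3].
  apply: integral_ae_eq => //=.
  + by apply/measurable_EFinP; exact: measurable_normal_pdf.
  + by move=> E _ mE; rewrite -h3.
Qed.

Lemma integrable_normal_prob (m s : R) (f : R -> \bar R) :
  (normal_prob m s).-integrable setT f ->
  mu.-integrable setT (fun x => f x * (normal_pdf m s x)%:E)%E.
Proof.
move=> intf; have mf := measurable_int (normal_prob m s) intf.
apply/integrableP; split.
  apply: emeasurable_funM => //=; apply/measurable_EFinP.
  exact: measurable_normal_pdf.
have /integrableP[_] := integrable_abse intf.
under eq_integral do rewrite abse_id.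
rewrite integral_normal_prob; last exact: integrable_abse.
under eq_integral do rewrite -[X in (_ * X)%E]gee0_abs ?lee_fin ?normal_pdf_ge0// -abseM.
by [].
Qed.

Context d (W : measurableType d) (Q : probability W R).

Lemma integrable_integral_law d' (T : measurableType d')
    (L : {measure set T -> \bar R}) (Y : W -> T) (f : T -> \bar R) :
  measurable_fun setT Y -> (forall B, measurable B -> Q (Y @^-1` B) = L B) ->
  measurable_fun setT f -> Q.-integrable setT (f \o Y) ->
  L.-integrable setT f /\ (\int[L]_y f y = \int[Q]_w f (Y w))%E.
Proof.
move=> mY QL mf intf.
pose X : {RV Q >-> T} := mfun_Sub (mem_set mY).
have intE : (\int[L]_y f y = \int[distribution Q X]_y f y)%E.
  by apply: eq_measure_integral => A mA _; rewrite -QL.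
have intaE : (\int[L]_y `|f y| = \int[distribution Q X]_y `|f y|)%E.
  by apply: eq_measure_integral => A mA _; rewrite -QL.
split; last by rewrite intE (integral_distribution (X := X)).
apply/integrableP; split => //; rewrite intaE.
have /integrableP[_ //] : (distribution Q X).-integrable setT f.
by apply: (@integrable_pushforward _ _ W T R Y mY Q setT f).
Qed.

(** Square integrability of [Y] is transported to its law and supplies the integrability that the
    moment formulas for the density assume. The case [v = 0] is a Dirac mass. *)
Lemma normal_law_moments (Y : W -> R) (m v : R) : 0 <= v ->
  Y \in Lfun Q 2%:E ->
  (forall B, measurable B -> Q (Y @^-1` B) = normal_law m v B) ->
  ('E_Q[Y] = m%:E /\ 'V_Q[Y] = v%:E)%E.
Proof.
move=> v0 LY QY; have mY : measurable_fun setT Y.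
  by move: LY; rewrite inE => /andP[/[!inE]/= ? _].
have L1Y : Y \in Lfun Q 1 by apply: Lfun_subset12 => //; exact: fin_num_measure.
have iY : Q.-integrable setT (EFin \o Y) by exact/Lfun1_integrable.
pose sq (y : R) := ((y - m) ^+ 2)%:E.
have msq : measurable_fun setT sq.
  apply/measurable_EFinP; apply: measurable_funX; exact: measurable_funB.
have iY2 : Q.-integrable setT (sq \o Y).
  have -> : sq \o Y = EFin \o (fun w => (Y \- cst m) w ^+ 2) by [].
  apply: Lfun2_integrable_sqr; apply: rpredB => //.
    by rewrite lee_fin ler1n.
  by move=> ?; exact: Lfun_cst.
have mid : measurable_fun setT (EFin : R -> \bar R) by exact/measurable_EFinP.
have VE : ('E_Q[Y] = m%:E -> 'V_Q[Y] = \int[Q]_w sq (Y w))%E.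
  by move=> EY; rewrite /variance covariance.unlock EY expectation.unlock.
have EE : ('E_Q[Y] = \int[Q]_w (Y w)%:E)%E by rewrite expectation.unlock.
move: QY; rewrite /normal_law; case: eqVneq => [->|vn0] QY.
  pose L := @dirac _ (measurableTypeR R) m R.
  have [_ I1] := @integrable_integral_law _ (measurableTypeR R) L Y _ mY QY mid iY.
  have [_ I2] := @integrable_integral_law _ (measurableTypeR R) L Y _ mY QY msq iY2.
  have EY : ('E_Q[Y] = m%:E)%E.
    by rewrite EE -I1 integral_dirac// diracT mul1e.
  split => //; rewrite VE// -I2 integral_dirac// diracT mul1e.
  by rewrite /sq subrr expr0n.
pose L := normal_prob m (Num.sqrt v).
have [J1 I1] := @integrable_integral_law _ (measurableTypeR R) L Y _ mY QY mid iY.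
have [J2 I2] := @integrable_integral_law _ (measurableTypeR R) L Y _ mY QY msq iY2.
have s0 : Num.sqrt v != 0 by rewrite gt_eqF// sqrtr_gt0 lt_neqAle eq_sym vn0.
have EY : ('E_Q[Y] = m%:E)%E.
  rewrite EE -I1 integral_normal_prob//; under eq_integral do rewrite -EFinM.
  apply: normal_pdf_mean => //.
  exact: (integrable_normal_prob J1).
split => //; rewrite VE// -I2 integral_normal_prob//.
under eq_integral do rewrite -EFinM.
rewrite normal_pdf_variance ?sqr_sqrtr//.
exact: (integrable_normal_prob J2).
Qed.

End normal_law.

(** * Linear combinations, second moments, measurability and covariances *)

(** In [gaussian_process] the coefficient is a function of the index, so an index repeated with
    different coefficients must first have them summed. *)
Lemma collect_linear_combination (R : comNzRingType) (T : eqType)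
    (l : seq (R * T)) : exists (s : seq T) (c : T -> R), forall z : T -> R,
  \sum_(p <- l) p.1 * z p.2 = \sum_(t <- s) c t * z t.
Proof.
exists (undup [seq p.2 | p <- l]), (fun t => \sum_(p <- l | p.2 == t) p.1) => z.
under [RHS]eq_bigr do rewrite big_distrl/=.
rewrite (exchange_big_dep xpredT)//= big_seq [RHS]big_seq.
apply: eq_bigr => p pl.
under eq_bigl do rewrite eq_sym.
rewrite big_mkcond (bigD1_seq p.2) ?undup_uniq ?mem_undup ?map_f//= eqxx.
by rewrite big1 ?addr0// => t /negbTE->.
Qed.

Section second_moments.
Context d (W : measurableType d) (R : realType) (Q : probability W R).

(** With zero mean the variance is the integral of the square, so a real value for it is already a
    finite second moment. *)
Lemma centered_Lfun2 (Y : W -> R) (k : R) : measurable_fun setT Y ->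
  ('E_Q[Y] = 0)%E -> ('V_Q[Y] = k%:E)%E -> Y \in Lfun Q 2%:E.
Proof.
move=> mY EY; rewrite /variance covariance.unlock EY expectation.unlock => VY.
rewrite inE; apply/andP; split; rewrite inE//=.
rewrite /finite_norm unlock/=.
apply: poweR_lty.
rewrite [ltLHS](_ : _ = k%:E) ?ltry// -VY.
apply: eq_integral => w _.
by rewrite /= powR_mulrn// real_normK ?num_real// fctE /= subr0 expr2.
Qed.

End second_moments.

Section measurability.
Context d d' (W : measurableType d) (S : measurableType d') (R : realType)
  (P : probability W R) (le : rel S) (Xs : nat -> {RV P >-> S})
  (mbelow : forall x, measurable (below le x))
  (mabove : forall x, measurable (above le x)).

Lemma measurable_Pn n A : measurable A ->
  measurable_fun setT (fun w => Pn Xs n w A).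
Proof.
move=> mA; apply: measurable_funM => //; apply: measurable_sum => i.
have -> : (fun w => \1_A (Xs i w) : R) = (\1_A : S -> R) \o Xs i by [].
apply: measurableT_comp => //; exact: measurable_indic.
Qed.

Lemma measurable_tau_hat n x :
  measurable_fun setT (fun w => tau_hat le Xs n w x).
Proof.
have mC := measurable_comparables mbelow mabove x.
(* The inverse is written as a real power, a measurable function of its base; the two agree on
   nonnegative numbers. *)
have -> : (fun w => tau_hat le Xs n w x) = fun w =>
    if 0 < Pn Xs n w (comparables le x) then
      Pn Xs n w (below le x `&` comparables le x) *
      Pn Xs n w (comparables le x) `^ (-1) else 0.
  by apply/funext => w; rewrite /tau_hat /Pn_cond powR_inv1// Pn_ge0.
apply: measurable_fun_ifT => //.
  by apply: measurable_fun_ltr => //; exact: measurable_Pn.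
apply: measurable_funM; first by apply: measurable_Pn; exact: measurableI.
apply: (measurableT_comp (f := @powR R ^~ (-1))) => //.
exact: measurable_Pn.
Qed.

End measurability.

Section covariance.
Context d (W : measurableType d) (R : realType) (Q : probability W R).

Lemma covariance_affine (U V U' V' : W -> R) (a b a' b' k1 k2 k3 k4 : R) :
  U \in Lfun Q 2%:E -> V \in Lfun Q 2%:E ->
  U' \in Lfun Q 2%:E -> V' \in Lfun Q 2%:E ->
  covariance Q U U' = k1%:E -> covariance Q U V' = k2%:E ->
  covariance Q V U' = k3%:E -> covariance Q V V' = k4%:E ->
  covariance Q (a \o* (U \- b \o* V)) (a' \o* (U' \- b' \o* V')) =
  (a * a' * (k1 - b' * k2 - b * k3 + b * b' * k4))%:E.
Proof.
move=> LU LV LU' LV' c1 c2 c3 c4.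
have L21 Y : Y \in Lfun Q 2%:E -> Y \in Lfun Q 1.
  by apply: Lfun_subset12 => //; exact: fin_num_measure.
have LZ Y c : Y \in Lfun Q 2%:E -> c \o* Y \in Lfun Q 2%:E.
  by apply: Lfun_scale; rewrite ler1n.
have LD Y Y' : Y \in Lfun Q 2%:E -> Y' \in Lfun Q 2%:E -> Y \- Y' \in Lfun Q 2%:E.
  by move=> *; apply: rpredB => //; rewrite lee_fin ler1n.
have LM Y Y' : Y \in Lfun Q 2%:E -> Y' \in Lfun Q 2%:E -> Y * Y' \in Lfun Q 1.
  exact: Lfun2_mul_Lfun1.
have Zl c Y Y' : Y \in Lfun Q 2%:E -> Y' \in Lfun Q 2%:E ->
    covariance Q (c \o* Y) Y' = (c%:E * covariance Q Y Y')%E.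
  by move=> LY LY'; apply: covarianceZl; [exact: L21|exact: L21|exact: LM].
have Zr c Y Y' : Y \in Lfun Q 2%:E -> Y' \in Lfun Q 2%:E ->
    covariance Q Y (c \o* Y') = (c%:E * covariance Q Y Y')%E.
  by move=> LY LY'; apply: covarianceZr; [exact: L21|exact: L21|exact: LM].
have LbV := LZ V b LV; have LbV' := LZ V' b' LV'.
have LD1 := LD _ _ LU LbV; have LD2 := LD _ _ LU' LbV'.
rewrite (Zl _ _ _ LD1 (LZ _ _ LD2)) (Zr _ _ _ LD1 LD2).
rewrite (covarianceBl LU LbV LD2) (covarianceBr LU LU' LbV').
rewrite (covarianceBr LbV LU' LbV') (Zl _ _ _ LV LU') (Zl _ _ _ LV LbV').
rewrite (Zr _ _ _ LU LV') (Zr _ _ _ LV LV') c1 c2 c3 c4.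
by rewrite !(=^~ EFinM, =^~ EFinB); congr EFin; ring.
Qed.

End covariance.

(** When [tz] or [ty] vanishes, denominators cannot be cleared: the right side is 0 through its
    leading factor, and the left side is 0 because the remaining [k]'s stand for probabilities of
    subsets of a null event. *)
Lemma Omega_algebra (R : fieldType) (tz ty pz py k1 k2 k3 k4 : R) :
  pz != 0 -> py != 0 -> (tz = 0 -> k1 = 0) -> (tz = 0 -> k2 = 0) ->
  (ty = 0 -> k1 = 0) -> (ty = 0 -> k3 = 0) ->
  pz^-1 * py^-1 * (k1 - tz * pz * (ty * py) - ty * (k2 - tz * pz * py)
    - tz * (k3 - pz * (ty * py)) + tz * ty * (k4 - pz * py)) =
  tz * ty * (k1 / (tz * pz * (ty * py)) + k4 / (pz * py)
    - k3 / (pz * (ty * py)) - k2 / (tz * pz * py)).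
Proof.
move=> pz0 py0; have [->|tz0] := eqVneq tz 0.
  by move=> -> // -> // _ _; ring.
have [->|ty0] := eqVneq ty 0.
  by move=> _ _ -> // -> //; ring.
by move=> _ _ _ _; field; rewrite pz0 py0 tz0 ty0.
Qed.

(** * Mean, covariance and Gaussianity of the limit process *)

Section limit_process.
Context d d' (W : measurableType d) (S : measurableType d') (R : realType)
  (P : probability W R) (le : rel S) (X : {RV P >-> S})
  (mbelow : forall x, measurable (below le x))
  (mabove : forall x, measurable (above le x))
  (pbar : R) (pbar_gt0 : 0 < pbar).
Context d'' (W' : measurableType d'') (Q : probability W' R)
  (Z : W' -> linfty (order_class le) R).

Context (mZ : measurable_fun setT (Z : W' -> borel (linfty (order_class le) R))).
Context (Z_gauss : gaussian_process Q (fun A w => Z w A)).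
Context (EZ : forall A, ('E_Q[fun w => Z w A] = 0)%E).
Context (covZ : forall A B,
  covariance Q (fun w => Z w A) (fun w => Z w B) =
  (Pr X (val A `&` val B) - Pr X (val A) * Pr X (val B))%:E).

Local Notation p := (p_ le X).
Local Notation tau := (tau le X).
Local Notation dmap := (delta_map X mbelow mabove pbar_gt0).
Local Notation G := (dmap \o Z).

Let ZB x w := Z w (below_class le x).
Let ZC x w := Z w (comparables_class le x).

Let GE x : (fun w => G w x) =
  (p (val x))^-1 \o* (ZB (val x) \- tau (val x) \o* ZC (val x)).
Proof. by apply/funext => w; rewrite /= /delta_fun (mulrC (tau _)). Qed.

Let LZ A : (fun w => Z w A) \in Lfun Q 2%:E.
Proof. by apply: centered_Lfun2 (covZ A A) => //; exact: Z_gauss.1. Qed.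

Let L21 (Y : W' -> R) : Y \in Lfun Q 2%:E -> Y \in Lfun Q 1.
Proof. by apply: Lfun_subset12 => //; exact: fin_num_measure. Qed.

Lemma delta_expectation x : ('E_Q[fun w => G w x] = 0)%E.
Proof.
have L2C : tau (val x) \o* ZC (val x) \in Lfun Q 2%:E.
  by apply: Lfun_scale; [rewrite ler1n|exact: LZ].
rewrite GE expectationZl; last first.
  by apply: L21; apply: rpredB => //; [rewrite lee_fin ler1n|move=> ?; exact: LZ].
rewrite expectationB; [|exact/L21/LZ|exact: L21].
rewrite expectationZl; last exact/L21/LZ.
by rewrite [X in (X - _)%E]EZ [X in (_ * (_ - _ * X))%E]EZ mule0 sube0 mule0.
Qed.

Lemma delta_covariance x y :
  covariance Q (fun w => G w x) (fun w => G w y) =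
  (Omega_cov le X (val x) (val y))%:E.
Proof.
rewrite !GE (covariance_affine _ _ _ _ (LZ _) (LZ _) (LZ _) (LZ _)
  (covZ _ _) (covZ _ _) (covZ _ _) (covZ _ _)); congr EFin.
have PB0 u A : C_ge le X pbar u -> measurable A -> tau u = 0 ->
    Pr X (below le u `&` A) = 0.
  move=> Cu mA tu; apply/eqP; rewrite eq_le Pr_ge0 andbT.
  rewrite (le_trans (Pr_mono X (B := below le u) _ _ _))//; first exact: measurableI.
  by rewrite (Pr_below pbar_gt0 Cu) tu mul0r.
have mC := measurable_comparables mbelow mabove.
have Cx := C_geP x; have Cy := C_geP y.
have px0 := lt_le_trans pbar_gt0 Cx; have py0 := lt_le_trans pbar_gt0 Cy.
rewrite /= /Omega_cov !(Pr_below pbar_gt0)//.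
apply: Omega_algebra.
- by rewrite gt_eqF.
- by rewrite gt_eqF.
- exact: PB0 Cx (mbelow _).
- exact: PB0 Cx (mC _).
- by rewrite setIC; exact: PB0 Cy (mbelow _).
- by rewrite setIC; exact: PB0 Cy (mC _).
Qed.

Lemma delta_gaussian : gaussian_process Q (fun x w => G w x).
Proof.
split.
  move=> x.
  have mG : measurable_fun setT (G : W' -> borel (linfty (C_ge le X pbar) R)).
    by apply: continuous_borel mZ; exact: delta_map_continuous.
  apply: (continuous_borel_measurable
    (h := fun b : linfty (C_ge le X pbar) R => b x) _ mG).
  exact: linfty_eval_continuous.
move=> s a.
(* Each coordinate of [G] contributes two coordinates of [Z], and different points may yield the
   same class. *)
pose l := flatten [seq [:: (a x / p (val x), below_class le (val x));
  (- (a x * tau (val x) / p (val x)), comparables_class le (val x))] | x <- s].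
have [s' [c cE]] := collect_linear_combination l.
have [m [v [v0 H]]] := Z_gauss.2 s' c.
exists m, v; split => // B mB; rewrite -H//; congr (Q (_ @^-1` B)).
apply/funext => w; rewrite -(cE (Z w)) /l big_flatten/= big_map.
apply: eq_bigr => x _; rewrite !big_cons big_nil /= /delta_fun; ring.
Qed.

End limit_process.

(** * The one-dimensional limit *)

Section default_display_measure.
Context (R : realType) (L : {measure set (measurableTypeR R) -> \bar R}).

(* [measurableTypeR R] and [R] have the same measurable sets, but the displays
   of their measurable structures differ, so that a measure on one is not a
   measure on the other. *)
Definition default_display_measure : set R -> \bar R := L.

HB.instance Definition _ := isMeasure.Build _ R R default_display_measure
  (measure0 L) (measure_ge0 L) (@measure_semi_sigma_additive _ _ _ L).

End default_display_measure.

(** [normal_law] is a bare set function defined by cases; the change of variables needs a measure on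
    [R] itself. *)
Lemma normal_lawP (R : realType) (m v : R) :
  exists L : {measure set R -> \bar R}, normal_law m v = L.
Proof.
rewrite /normal_law; case: eqVneq => _.
  by exists (@dirac _ R m R).
by exists (default_display_measure (normal_prob m (Num.sqrt v))).
Qed.

(** The lower set lies inside the comparables, so for nonzero [tau] the bracket is
    [1 / (tau * p) - 1 / p]; for [tau = 0] both sides vanish. *)
Lemma Omega_cov_diag d d' (W : measurableType d) (S : measurableType d')
    (R : realType) (P : probability W R) (le : rel S) (X : {RV P >-> S})
    (pbar : R) x : 0 < pbar -> C_ge le X pbar x ->
  Omega_cov le X x x = tau le X x * (1 - tau le X x) / p_ le X x.
Proof.
move=> pbar0 Cx; have p0 := lt_le_trans pbar0 Cx.
rewrite /Omega_cov !setIid (setIC (comparables le x)) below_comparables.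
rewrite (Pr_below pbar0 Cx) -[Pr X (comparables le x)]/(p_ le X x).
move: (tau le X x) (p_ le X x) p0 => t p p0.
have [->|t0] := eqVneq t 0; first by rewrite !mul0r.
by field; rewrite t0 gt_eqF.
Qed.

Unset Implicit Arguments.
Set Strict Implicit.
Set Printing Implicit Defensive.

Theorem theorem3 (R : realType) (d d' : measure_display)
    (W : measurableType d) (S : measurableType d') (P : probability W R)
    (le : rel S) (le_refl : reflexive le) (le_anti : antisymmetric le)
    (le_trans : transitive le)
    (mbelow : forall x, measurable (below le x))
    (mabove : forall x, measurable (above le x))
    (X : {RV P >-> S}) (Xs : nat -> {RV P >-> S})
    (pbar : R) (pbar_gt0 : 0 < pbar)
    (v : nat -> R)
    (E1 : iid_copies X Xs)
    (E2 : pbar < 1 ->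
       (forall n, 0 < v n) /\
       bigO_P P (fun n w => sup [set rel_error le X Xs n w x | x in C_ge le X pbar])
                (fun n => Num.sqrt (v n / n%:R)))
    (E6 : weak_cvg_gaussian P (alpha X Xs mbelow mabove)
       (fun A B => Pr X (val A `&` val B) - Pr X (val A) * Pr X (val B)))
    (hv : v =o_\oo (fun n => n%:R : R)) :
  (forall x, C_ge le X pbar x ->
     cvg_in_distribution P
       (fun n w => Num.sqrt n%:R * (tau_hat le Xs n w x - tau le X x))
       (normal_law 0 (tau le X x * (1 - tau le X x) / p_ le X x))) /\
  weak_cvg_gaussian P (beta X Xs mbelow mabove pbar)
    (fun z y => Omega_cov le X (val z) (val y)).
Proof.
have [dZ [W' [Q [Z [wZ gZ EZ covZ]]]]] := E6.
have mZ := wZ.1.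
pose G := delta_map X mbelow mabove pbar_gt0 \o Z.
have wG : weak_cvg P (beta X Xs mbelow mabove pbar) Q G.
  apply: weak_cvg_asymptotic_image wZ; first exact: delta_map_continuous.
  exact: beta_asymptotic_image.
have gG : gaussian_process Q (fun x w => G w x) by exact: delta_gaussian.
have EG x : ('E_Q[fun w => G w x] = 0)%E by exact: delta_expectation.
have covG x y : covariance Q (fun w => G w x) (fun w => G w y) =
    (Omega_cov le X (val x) (val y))%:E by exact: delta_covariance.
split; last by exists dZ, W', Q, G.
move=> x Cx; pose cx : C_ge le X pbar := exist _ x (mem_set Cx).
have mYn n : measurable_fun setT (fun w =>
    Num.sqrt n%:R * (tau_hat le Xs n w x - tau le X x)).
  by apply: measurable_funM => //; apply: measurable_funB => //;
     exact: measurable_tau_hat.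
split => // f fc fb; have [M fM] := bounded_fun_bound fb.
have mf : measurable_fun setT f by exact: continuous_measurable_fun.
have mGx : measurable_fun setT (fun w => G w cx) by exact: gG.1.
(* The statistic at [x] is measurable, so its expectations are outer expectations of a continuous
   functional of the process: [f] after evaluation at [x]. *)
have -> : (fun n => \int[P]_w
    (f (Num.sqrt n%:R * (tau_hat le Xs n w x - tau le X x)))%:E)%E =
    (fun n => outer_expectation P
      ((fun b : linfty (C_ge le X pbar) R => f (b cx)) \o
       beta X Xs mbelow mabove pbar n)).
  apply/funext => n; rewrite (@outer_expectation_measurable _ _ _ _ _ M)//.
    by apply: measurableT_comp => //; exact: mYn.
  by move=> w; exact: fM.
(* A single coordinate with coefficient 1 is normal with unknown mean [m] and variance [s],
   identified below from the computed expectation and covariance. *)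
have [m [s [s0 lawG]]] := gG.2 [:: cx] (fun=> 1).
have {}lawG B : measurable B -> Q ((fun w => G w cx) @^-1` B) = normal_law m s B.
  move=> mB; rewrite -lawG//; congr (Q (_ @^-1` B)).
  by apply/funext => w; rewrite big_cons big_nil mul1r addr0.
have LG : (fun w => G w cx) \in Lfun Q 2%:E.
  by apply: centered_Lfun2 (covG cx cx).
have [EGm VGs] := normal_law_moments s0 LG lawG.
have m0 : m = 0 by move: EGm; rewrite EG => -[].
have sE : s = tau le X x * (1 - tau le X x) / p_ le X x.
  move: VGs; rewrite /variance covG => -[<-].
  by rewrite (Omega_cov_diag pbar_gt0 Cx).
rewrite m0 sE in lawG.
have [L LE] := normal_lawP 0 (tau le X x * (1 - tau le X x) / p_ le X x).
rewrite LE in lawG *.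
(* The integral against the normal law becomes the expectation of [f] at the coordinate [x] of [G],
   the limit given by the weak convergence of the process. *)
have [_ ->] := @integrable_integral_law _ _ _ Q _ _ L (fun w => G w cx) (fun y => (f y)%:E) mGx lawG
  ((measurable_EFinP _ _).2 mf)
  (bounded_measurable_integrable Q (measurableT_comp mf mGx) (fun w => fM _)).
apply: wG.2.
  move=> b; apply: (cvg_comp (fun b : linfty (C_ge le X pbar) R => b cx) f).
    exact: linfty_eval_continuous.
  exact: fc.
by apply: bounded_fun_le => b; exact: fM.
Qed.
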